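(* Fix an integer base $b\ge 2$. There exists a real number $x=0.a_1a_2a_3\dots\in[0,1)$ (written in base $b$) that is \emph{not} base-$b$ normal, such that for every $k\in\mathbb{N}$ and every $\ell\in\mathbb{N}$ with $\ell\ge 2$, the number $0.a_ka_{k+\ell}a_{k+2\ell}\dots$ is base-$b$ normal.
   Context: $\mathbb{N}=\{1,2,3,\dots\}$. For $x\in[0,1)$ with base-$b$ expansion $x=0.a_1a_2a_3\dots$ (digits $a_i\in\{0,1,\dots,b-1\}$), $x$ is called (base-$b$) normal if for every $k\ge1$ and every finite string $[d_1,\dots,d_k]$ with $d_i\in\{0,1,\dots,b-1\}$, $$\lim_{n\to\infty}\frac{\#\{0\le i\le n-1: a_{i+j}=d_j \text{ for } j=1,\dots,k\}}{n}=\frac{1}{b^k}.$$ A digit sequence $0.c_1c_2c_3\dots$ is called normal if the corresponding real number (equivalently, the digit sequence, by the same frequency condition) is normal. *)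

(* Defs.v *)
From mathcomp Require Import all_boot all_order all_algebra.
From mathcomp Require Import all_classical all_reals all_analysis.

Set Implicit Arguments.
Unset Strict Implicit.
Unset Printing Implicit Defensive.

Import Order.TTheory GRing.Theory Num.Theory.
Import numFieldNormedType.Exports.

Local Open Scope classical_set_scope.
Local Open Scope ring_scope.

(* Digit sequences are functions [a : nat -> nat] read from index 1 on
   (0.a_1 a_2 a_3 ...); the value at index 0 is never used. *)

(* The i-th digit (1 <= i) of the base-b expansion of x >= 0. For a b-adic
   rational this selects the expansion that ends in zeros. *)
Definition digit (R : realType) (b : nat) (x : R) (i : nat) : nat :=
  (Num.truncn (b%:R ^+ i * x) %% b)%N.

Definition of_digits (R : realType) (b : nat) (c : nat -> nat) : R :=
  limn (fun n : nat => \sum_(1 <= i < n.+1) ((c i)%:R / b%:R ^+ i) : R).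

(* The entry d_(j+1) of the string [d_1, ..., d_k] is [tnth d j]. *)
Definition occurrences (b : nat) (a : nat -> nat) (k : nat)
    (d : k.-tuple 'I_b) (n : nat) : nat :=
  #|[pred i : 'I_n | [forall j : 'I_k, a (i + j.+1)%N == tnth d j]]|.

Definition normal_digits (R : realType) (b : nat) (a : nat -> nat) : Prop :=
  forall (k : nat) (d : k.-tuple 'I_b), (1 <= k)%N ->
    (fun n : nat => (occurrences a d n)%:R / n%:R : R) @ \oo
      --> (1 / b%:R ^+ k : R).

Definition normal (R : realType) (b : nat) (x : R) : Prop :=
  0 <= x < 1 /\ normal_digits R b (digit b x).

(* The digit sequence a_k, a_(k+l), a_(k+2l), ..., again indexed from 1. *)
Definition progression (a : nat -> nat) (k l : nat) : nat -> nat :=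
  fun i => a (k + i.-1 * l)%N.

(* Main.v *)
(* Let c be a digit sequence and a_i = c_(i %/ 2). An arithmetic progression of
   difference at least 2 meets each pair {2q, 2q+1} at most once, so it reads c
   along a strictly increasing map; but the word [0, 1] never straddles such a
   pair, so its frequency in a is 1/(2 b^2) when c is normal. It remains to find
   c that is normal along countably many increasing maps of linear growth. The
   frequency of a word w x minus 1/b times that of w is the mean gain of a
   strategy that bets on the digit x each time w has just been read. Choosing
   each digit greedily so that a weighted sum of squared gains grows by at most
   its average keeps all gains O(sqrt n). *)
Require Import Defs.
From mathcomp Require Import all_boot all_order all_algebra.
From mathcomp Require Import all_classical all_reals all_analysis.
From mathcomp Require Import lra ring zify.

Import Order.TTheory GRing.Theory Num.Theory.
Import numFieldNormedType.Exports.

Set Implicit Arguments.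
Unset Strict Implicit.
Unset Printing Implicit Defensive.

Local Open Scope classical_set_scope.
Local Open Scope ring_scope.

(** * Betting strategies and greedy digits *)

(** [g h x] is what a strategy wins when the digit [x] follows the history [h]. *)
Definition gain (R : realFieldType) (g : seq nat -> nat -> R) (h : seq nat) : R :=
  \sum_(t < size h) g (take t h) (nth 0%N h t).

Lemma gain_rcons (R : realFieldType) (g : seq nat -> nat -> R) h x :
  gain g (rcons h x) = gain g h + g h x.
Proof.
rewrite /gain size_rcons big_ord_recr /= -cats1 take_size_cat // nth_cat ltnn subnn.
congr (_ + _); apply: eq_bigr => t _.
by rewrite take_cat nth_cat ltn_ord.
Qed.

Lemma gain_bound (R : realFieldType) (g : seq nat -> nat -> R) h :
  (forall h x, `|g h x| <= 1) -> `|gain g h| <= (size h)%:R.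
Proof.
move=> g1; apply: le_trans (ler_norm_sum _ _ _) _.
apply: le_trans (ler_sum _ (fun t _ => g1 _ _)) _.
by rewrite sumr_const card_ord.
Qed.

Lemma gain_mkseq (R : realFieldType) (g : seq nat -> nat -> R) c n :
  gain g (mkseq c n) = \sum_(t < n) g (mkseq c t) (c t).
Proof.
elim: n => [|n IH]; first by rewrite /gain !big_ord0.
by rewrite mkseqS gain_rcons IH big_ord_recr.
Qed.

(** On average over [x] the cross terms [2 * S m * g m x] vanish and the squares add at most 1, so
    some [x] does no worse than this average. *)
Lemma square_sum_step (R : realFieldType) (b n : nat) (w S : 'I_n -> R)
    (g : 'I_n -> nat -> R) :
  (0 < b)%N -> (forall m, 0 <= w m) ->
  (forall m, \sum_(x < b) g m x = 0) -> (forall m x, `|g m x| <= 1) ->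
  exists2 x, (x < b)%N &
    \sum_m w m * (S m + g m x) ^+ 2 <= \sum_m w m * (S m ^+ 2 + 1).
Proof.
move=> b0 w0 gmean g1.
have : [exists x : 'I_b, \sum_m w m * (S m + g m x) ^+ 2
                         <= \sum_m w m * (S m ^+ 2 + 1)].
  apply: contraT; rewrite negb_exists => /forallP H.
  have : \sum_(x < b) \sum_m w m * (S m ^+ 2 + 1)
       < \sum_(x < b) \sum_m w m * (S m + g m x) ^+ 2.
    apply: ltr_sum; last by move=> x _; rewrite ltNge.
    by apply/hasP; exists (Ordinal b0); rewrite ?mem_index_enum.
  rewrite ltNge exchange_big [leRHS]exchange_big /= ler_sum // => m _.
  rewrite -!mulr_sumr ler_wpM2l //.
  have -> : \sum_(x < b) (S m + g m x) ^+ 2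
          = \sum_(x < b) (S m ^+ 2 + g m x ^+ 2) + 2 * S m * \sum_(x < b) g m x.
    by rewrite mulr_sumr -big_split; apply: eq_bigr => x _ /=; ring.
  rewrite gmean mulr0 addr0 ler_sum // => x _.
  by rewrite lerD2l -real_normK ?num_real // expr_le1.
by move=> /existsP[x Hx]; exists x.
Qed.

(* The factor m.+1 ^ 2 pays for the squared gain, at most m.+1 ^ 2, that the
   m-th strategy may have accumulated when it enters the potential. *)
Definition weight (R : realFieldType) (m : nat) : R := (2 ^+ m * m.+1%:R ^+ 2)^-1.

Lemma weight_gt0 (R : realFieldType) m : 0 < weight R m.
Proof. by rewrite invr_gt0 mulr_gt0 ?exprn_gt0 ?ltr0n. Qed.

(** This bounds one step of the potential: each of the [n] strategies already counted adds its
    weight, and the [n]-th one enters with at most [weight R n * n.+1 ^ 2]. *)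
Lemma weight_sum (R : realFieldType) n :
  \sum_(m < n) weight R m + weight R n * n.+1%:R ^+ 2 <= 2.
Proof.
have -> : weight R n * n.+1%:R ^+ 2 = 2 ^- n.
  by rewrite /weight invfM mulfVK // expf_neq0 // pnatr_eq0.
suff : \sum_(m < n) weight R m <= 2 - 2 * 2 ^- n.
  have : 0 < (2 : R) ^- n by rewrite invr_gt0 exprn_gt0.
  by lra.
elim: n => [|n IH]; first by rewrite big_ord0 expr0 invr1; lra.
rewrite big_ord_recr /=.
have : weight R n <= 2 ^- n.
  rewrite /weight lef_pV2 ?posrE ?mulr_gt0 ?exprn_gt0 ?ltr0n //.
  by rewrite ler_peMr ?exprn_ge0 // exprn_ege1 // ler1n.
rewrite exprS invfM.
move: (_ ^- n) (weight R n) (\sum_(_ < _) _) IH => u v s; lra.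
Qed.

Lemma small_gains (R : realType) (b : nat) (g : nat -> seq nat -> nat -> R) :
  (0 < b)%N -> (forall m h, \sum_(x < b) g m h x = 0) ->
  (forall m h x, `|g m h x| <= 1) ->
  exists2 c : nat -> nat, (forall t, (c t < b)%N) &
    forall m n, (m < n)%N ->
      (\sum_(t < n) g m (mkseq c t) (c t)) ^+ 2 <= 2 / weight R m * n%:R.
Proof.
move=> b0 gmean g1.
(* At time [n] only the first [n] strategies count, so the potential is a finite sum; it grows by at
   most 2 per step and dominates each of its terms. *)
pose Phi n h := \sum_(m < n) weight R m * gain (g m) h ^+ 2.
have step h : exists x, (x < b)%N /\
    Phi (size h).+1 (rcons h x) <=
    \sum_(m < (size h).+1) weight R m * (gain (g m) h ^+ 2 + 1).
  have [x xb Hx] := @square_sum_step R b (size h).+1 (fun m => weight R m)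
    (fun m => gain (g m) h) (fun m => g m h) b0 (fun m => ltW (weight_gt0 R m))
    (fun m => gmean m h) (fun m => g1 m h).
  exists x; split => //; rewrite /Phi (le_trans _ Hx) // ler_sum // => m _.
  by rewrite gain_rcons.
have [ch chP] := choice step.
pose H := fix H n := if n is n'.+1 then rcons (H n') (ch (H n')) else [::].
pose c t := ch (H t).
have HE n : mkseq c n = H n by elim: n => // n IH; rewrite mkseqS IH.
have sH n : size (H n) = n by rewrite -HE size_mkseq.
have PhiH n : Phi n (H n) <= 2 * n%:R.
  elim: n => [|n IH]; first by rewrite /Phi big_ord0 mulr0.
  have [_] := chP (H n); rewrite sH => /le_trans; apply.
  rewrite big_ord_recr /=; under eq_bigr do rewrite mulrDr mulr1.
  rewrite big_split /= -/(Phi n (H n)).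
  (* The newcomer has gained at most [n] in absolute value, and [n ^ 2 + 1 <= n.+1 ^ 2]. *)
  have : weight R n * (gain (g n) (H n) ^+ 2 + 1) <= weight R n * n.+1%:R ^+ 2.
    rewrite ler_pM2l ?weight_gt0 //.
    have := gain_bound (H n) (g1 n); rewrite sH => gn.
    have : gain (g n) (H n) ^+ 2 <= n%:R ^+ 2.
      by rewrite -real_normK ?num_real // lerXn2r ?nnegrE.
    have : 0 <= n%:R :> R by [].
    rewrite -(natr1 n); move: (_ ^+ 2) n%:R => u v; nra.
  have := weight_sum R n; rewrite -(natr1 n).
  move: (Phi _ _) (weight R n * _) (weight R n * _) (\sum_(_ < _) _) IH => ? ? ? ?.
  lra.
exists c => [t|m n mn]; first by have [] := chP (H t).
rewrite -gain_mkseq HE mulrAC ler_pdivlMr ?weight_gt0 // (le_trans _ (PhiH n)) //.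
rewrite /Phi (bigD1 (Ordinal mn)) //= mulrC lerDl sumr_ge0 // => i _.
by rewrite mulr_ge0 ?sqr_ge0 // ltW // weight_gt0.
Qed.

(** * Real numbers with prescribed digits *)

(* The integer with base-b digits c_1 ... c_n. *)
Definition digit_prefix (b : nat) (c : nat -> nat) (n : nat) : nat :=
  foldl (fun N i => N * b + c i.+1)%N 0%N (iota 0 n).

Lemma digit_prefixS b c n :
  digit_prefix b c n.+1 = (digit_prefix b c n * b + c n.+1)%N.
Proof. by rewrite /digit_prefix -{1}addn1 iotaD foldl_cat. Qed.

Lemma partial_sum_prefix (R : realType) (b : nat) (c : nat -> nat) n : (0 < b)%N ->
  \sum_(1 <= i < n.+1) ((c i)%:R / b%:R ^+ i)
    = (digit_prefix b c n)%:R / b%:R ^+ n :> R.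
Proof.
move=> b0; elim: n => [|n IH]; first by rewrite big_nil mul0r.
have bN0 : b%:R != 0 :> R by rewrite pnatr_eq0 -lt0n.
rewrite big_nat_recr //= IH digit_prefixS natrD natrM mulrDl; congr (_ + _).
by rewrite exprS invfM mulrA mulfK.
Qed.

Section Digits.
Context (R : realType) (b : nat) (c : nat -> nat).
Hypotheses (b0 : (0 < b)%N) (cb : forall i, (c i < b)%N).
(* The expansion does not end in digits b - 1 only. *)
Hypothesis cinf : forall n, exists2 m, (n < m)%N & (c m).+1 <> b.

Let S n : R := \sum_(1 <= i < n.+1) ((c i)%:R / b%:R ^+ i).
(** [S n] and [T n] are the ends of nested intervals, given by the first [n] digits, that close in
    on the number. *)
Let T n : R := S n + b%:R ^- n.

Let bX n : 0 < b%:R ^- n :> R.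
Proof. by rewrite invr_gt0 exprn_gt0 // ltr0n. Qed.

Let SS n : S n.+1 = S n + (c n.+1)%:R * b%:R ^- n.+1.
Proof. by rewrite /S big_nat_recr. Qed.

Let S_homo : {homo S : n m / (n <= m)%N >-> n <= m}.
Proof.
apply: homo_leq => // [? ? ?|n]; first exact: le_trans.
by rewrite SS lerDl mulr_ge0 // ltW.
Qed.

Let TS n : T n.+1 = T n - (b%:R - (c n.+1).+1%:R) * b%:R ^- n.+1.
Proof.
have -> : T n = S n + b%:R * b%:R ^- n.+1.
  by rewrite /T exprS invfM mulVKf // pnatr_eq0 -lt0n.
by rewrite /T SS -(natr1 (c _)); ring.
Qed.

Let T_homo : {homo T : n m / (n <= m)%N >-> m <= n}.
Proof.
apply: (@homo_leq _ T (fun x y => y <= x)) => // [x y z yx zy|n].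
  exact: le_trans zy yx.
by rewrite TS gerBl mulr_ge0 ?(ltW (bX _)) // subr_ge0 ler_nat.
Qed.

Let ST n m : S n <= T m.
Proof.
apply: le_trans (S_homo (leq_maxl n m)) _.
by apply: le_trans (T_homo (leq_maxr n m)); rewrite lerDl ltW.
Qed.

Let x := of_digits R b c.

Let S_cvg : cvgn S.
Proof.
apply: nondecreasing_is_cvgn => //; exists (T 0) => _ [n _ <-]; exact: ST.
Qed.

Let of_digits_itv n : S n <= x < S n + b%:R ^- n.
Proof.
apply/andP; split; first exact: nondecreasing_cvgn_le.
(* A digit below [b - 1] after position [n] makes [T] drop strictly; this gives the strict upper
   bound that [truncn] requires. *)
have [m nm cm] := cinf n; have m0 : (0 < m)%N by case: m nm {cm}.
apply: (@le_lt_trans _ _ (T m)).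
  by apply: limr_le => //; near=> k; exact: ST.
apply: (@lt_le_trans _ _ (T m.-1)); last by apply: T_homo; rewrite -ltnS prednK.
rewrite -(prednK m0) TS /= gtrBl mulr_gt0 // subr_gt0 ltr_nat prednK //.
by rewrite ltn_neqAle cb andbT; apply/eqP.
Unshelve. all: by end_near. Qed.

Lemma of_digits_ge0_lt1 : 0 <= of_digits R b c < 1.
Proof. by have := of_digits_itv 0; rewrite /S big_nil add0r expr0 invr1. Qed.

(** Scaled by [b ^ i], the number lies in [[N, N + 1)] for the integer [N] formed by its first [i]
    digits, and the last digit of [N] is [c i]. *)
Lemma digit_of_digits i : (0 < i)%N -> digit b (of_digits R b c) i = c i.
Proof.
case: i => // n _; have := of_digits_itv n.+1; rewrite /S partial_sum_prefix //.
have bn0 : 0 < b%:R ^+ n.+1 :> R by rewrite exprn_gt0 // ltr0n.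
rewrite -[X in _ + X]mul1r -mulrDl natr1 ler_pdivrMr // ltr_pdivlMr // mulrC => H.
rewrite /digit (truncn_def H).
by rewrite digit_prefixS modnMDl modn_small.
Qed.
End Digits.

(** * Bets on words along increasing maps *)

Lemma small_gains_countable (R : realType) (b : nat) (I : countType)
    (g : I -> seq nat -> nat -> R) :
  (0 < b)%N -> (forall m h, \sum_(x < b) g m h x = 0) ->
  (forall m h x, `|g m h x| <= 1) ->
  exists2 c : nat -> nat, (forall t, (c t < b)%N) &
    forall m, exists C : R, forall n, (pickle m < n)%N ->
      (\sum_(t < n) g m (mkseq c t) (c t)) ^+ 2 <= C * n%:R.
Proof.
move=> b0 gmean g1.
(* Numbers that encode no index get the zero strategy. *)
pose g' m h x : R := if unpickle m is Some i then g i h x else 0.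
have [||c cb Hc] := @small_gains R b g' b0.
- by move=> m h; rewrite /g'; case: unpickle => //; rewrite big1.
- by move=> m h x; rewrite /g'; case: unpickle => [i|]; rewrite ?normr0.
exists c => // m; exists (2 / weight R (pickle m)) => n mn.
by have := Hc _ _ mn; rewrite /g' pickleK.
Qed.

(** Words are plain sequences here, so that induction can append one digit at a time. *)
Definition word_at (a : nat -> nat) (w : seq nat) (i : nat) : bool :=
  mkseq (fun j => a (i + j)%N) (size w) == w.

Lemma word_at_rcons a w x i :
  word_at a (rcons w x) i = word_at a w i && (a (i + size w)%N == x).
Proof. by rewrite /word_at size_rcons mkseqS eqseq_rcons. Qed.

Lemma occurrencesE b a k (d : k.-tuple 'I_b) n :
  occurrences a d n = (\sum_(i < n) word_at (fun i => a i.+1) (map val d) i)%N.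
Proof.
rewrite /occurrences -sum1_card big_mkcond; apply: eq_bigr => i _ /=.
rewrite inE; set P := [forall _, _].
suff -> : P = word_at (fun i => a i.+1) (map val d) i by case: word_at.
have sd : size (map val d) = k by rewrite size_map size_tuple.
have nd (j : 'I_k) : nth 0%N (map val d) j = tnth d j.
  by rewrite -tnth_nth tnth_map.
apply/forallP/eqP => [H|H j].
  apply: (@eq_from_nth _ 0%N) => [|j]; rewrite size_mkseq // => js.
  rewrite nth_mkseq //; rewrite sd in js.
  by rewrite (nd (Ordinal js)) -(eqP (H (Ordinal js))) addnS.
by rewrite -nd -H nth_mkseq ?sd // addnS.
Qed.

(* Stakes on x at time f (i + size w) if w was read along f from index i on;
   at most one term is nonzero when f is injective. *)
Definition bet (R : realType) (b : nat) (f : nat -> nat) (w : seq nat) (x : nat)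
    (h : seq nat) (y : nat) : R :=
  \sum_(i < (size h).+1 | f (i + size w)%N == size h)
    (word_at (nth 0%N h \o f) w i)%:R * ((y == x)%:R - b%:R^-1).

Section Bet.
Context (R : realType) (b : nat) (f : nat -> nat) (w : seq nat).
Hypotheses (b0 : (0 < b)%N) (f_mono : {homo f : i j / (i < j)%N}).

Let f_inj : injective f.
Proof.
by move=> i j; case: (ltngtP i j) => // /f_mono + E; rewrite E ltnn.
Qed.

Let f_ge i : (i <= f i)%N.
Proof. by elim: i => // i IH; apply: leq_ltn_trans IH (f_mono _). Qed.

Lemma bet_mean0 x h : (x < b)%N -> \sum_(y < b) bet R b f w x h y = 0.
Proof.
move=> xb; rewrite exchange_big big1 //= => i _.
rewrite -mulr_sumr sumrB sumr_const card_ord -[b%:R^-1 *+ b]mulr_natl divff.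
  rewrite (bigD1 (Ordinal xb)) //= eqxx big1 ?addr0 ?subrr ?mulr0 // => j.
  by rewrite -val_eqE /= => /negbTE->.
by rewrite pnatr_eq0 -lt0n.
Qed.

Lemma bet_le1 x h y : `|bet R b f w x h y| <= 1.
Proof.
rewrite /bet; case: (pickP (fun i : 'I_(size h).+1 => f (i + size w)%N == size h)).
  move=> i0 /eqP Hi0; rewrite (big_pred1 i0) => [|i].
    rewrite normrM ger0_norm // mulr_ile1 //; first by case: word_at.
    have : b%:R^-1 <= 1 :> R by rewrite invf_le1 ?ler1n ?ltr0n.
    have : 0 <= b%:R^-1 :> R by rewrite invr_ge0.
    rewrite ler_norml; case: eqP => _ /=; move: (b%:R^-1) => v v0 v1.
      by apply/andP; split; lra.
    by apply/andP; split; lra.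
  apply/eqP/eqP => [Hi|->//].
  by apply/val_inj/(@addIn (size w))/f_inj; rewrite Hi Hi0.
by move=> H; rewrite big_pred0 // normr0.
Qed.

(** The bet opened at index [i] is settled at time [f (i + size w)], so exactly those with [i < n]
    are settled before time [f (n + size w)]. Exchanging the sums over times and indices collects
    them. *)
Lemma sum_bet x c n :
  \sum_(t < f (n + size w)%N) bet R b f w x (mkseq c t) (c t) =
  (\sum_(i < n) word_at (c \o f) (rcons w x) i)%:R
    - (\sum_(i < n) word_at (c \o f) w i)%:R / b%:R.
Proof.
set N := f _; set m := size w.
pose F i : R := (word_at (c \o f) w i)%:R * ((c (f (i + m)%N) == x)%:R - b%:R^-1).
have betE (t : 'I_N) :
    bet R b f w x (mkseq c t) (c t) = \sum_(i < N | f (i + m)%N == t) F i.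
  pose G i : R := (word_at (nth 0%N (mkseq c t) \o f) w i)%:R
    * ((c t == x)%:R - b%:R^-1).
  rewrite /bet size_mkseq.
  rewrite (big_ord_widen_cond N (fun i => f (i + m)%N == t) G) //.
  rewrite {}/G.
  apply: eq_big => [i|i /andP[/eqP ft _]].
    case: eqP => //= <-; rewrite ltnS; apply: leq_trans (f_ge _); exact: leq_addr.
  rewrite /F ft; congr (_%:R * _); congr (nat_of_bool (_ == _)).
  (* The word is read at times [f (i + j) < t], where the history agrees with [c]. *)
  apply/eq_in_map => j; rewrite mem_iota /= => jw.
  by rewrite nth_mkseq // -ft f_mono // ltn_add2l.
rewrite (eq_bigr _ (fun t _ => betE t)) (exchange_big_dep xpredT) //=.
have FE (i : 'I_N) :
    \sum_(t < N | f (i + m)%N == t) F i = if (i < n)%N then F i else 0.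
  have fN : (f (i + m) < N)%N = (i < n)%N.
    rewrite /N -/m; case: (ltngtP i n) => [h|h|->]; last by rewrite ltnn.
      by rewrite f_mono // ltn_add2r.
    by apply/negbTE; rewrite -leqNgt ltnW // f_mono // ltn_add2r.
  case: ifPn => [|]; rewrite -fN => Hi.
    by rewrite (big_pred1 (Ordinal Hi)) // => t; rewrite -val_eqE eq_sym.
  rewrite big_pred0 // => t; apply: contraNF Hi => /eqP->; exact: ltn_ord.
rewrite (eq_bigr _ (fun i _ => FE i)) -big_mkcond /= -(big_ord_widen N F).
  rewrite !natr_sum mulr_suml -sumrB; apply: eq_bigr => i _.
  rewrite word_at_rcons /F mulrBr /=.
  by case: word_at; case: (_ == _); rewrite /= ?mul1r ?mul0r.
by apply: leq_trans (f_ge _); exact: leq_addr.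
Qed.
End Bet.

(** * Normality along countably many maps *)

Lemma cvg_div_of_sq_le (R : realType) (u : nat -> R) (C : R) :
  (\forall n \near \oo, u n ^+ 2 <= C * n%:R) -> (u n / n%:R) @[n --> \oo] --> 0.
Proof.
move=> uC; apply/cvgrPdist_le => e e0; near=> n.
have n0 : 0 < n%:R :> R by rewrite ltr0n; near: n; exact: nbhs_infty_gt.
rewrite sub0r normrN normrM normfV (gtr0_norm n0) ler_pdivrMr //.
rewrite -ler_sqr ?nnegrE ?mulr_ge0 ?(ltW e0) ?(ltW n0) //.
rewrite real_normK ?num_real //.
have : u n ^+ 2 <= C * n%:R by near: n.
(* From here on [C * n <= (e * n) ^ 2]. *)
have : C / e ^+ 2 <= n%:R by near: n; exact: nbhs_infty_ger.
rewrite ler_pdivrMr ?exprn_gt0 // => Cn /le_trans; apply.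
by rewrite exprMn expr2 mulrA ler_wpM2r ?(ltW n0) // mulrC (le_trans Cn) // mulrC.
Unshelve. all: by end_near. Qed.

Lemma simultaneous_normal (R : realType) (b : nat) (I : countType)
    (f : I -> nat -> nat) :
  (0 < b)%N -> (forall i, {homo f i : m n / (m < n)%N}) ->
  (forall i, exists A, forall n, (f i n <= A * n.+1)%N) ->
  exists2 c : nat -> nat, (forall t, (c t < b)%N) &
    forall i, normal_digits R b (fun n => c (f i n.-1)).
Proof.
move=> b0 f_mono f_lin.
have [||c cb Hc] := @small_gains_countable R b (I * seq nat * 'I_b)%type
  (fun m => bet R b (f m.1.1) m.1.2 m.2) b0.
- by move=> [[i w] x] h; exact: bet_mean0.
- by move=> [[i w] x] h y; exact: bet_le1.
exists c => // i.
have word_freq w : all (fun x => x < b)%N w ->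
    ((\sum_(j < n) word_at (c \o f i) w j)%:R / n%:R : R) @[n --> \oo]
      --> (1 / b%:R ^+ size w : R).
  elim/last_ind: w => [_|w x IH]; last rewrite all_rcons => /andP[xb /IH{}IH].
    rewrite expr0 divr1; apply: cvg_near_cst; near=> n.
    rewrite (eq_bigr (fun=> 1%N)) // sum1_card card_ord divff // pnatr_eq0 -lt0n.
    by near: n; exact: nbhs_infty_gt.
  (* [D n] is the total gain of the bet on [x] after [w]; the frequency of [rcons w x] is that of
     [w] over [b], plus [D n / n]. *)
  pose D n : R := (\sum_(j < n) word_at (c \o f i) (rcons w x) j)%:R
    - (\sum_(j < n) word_at (c \o f i) w j)%:R / b%:R.
  have -> : (fun n => (\sum_(j < n) word_at (c \o f i) (rcons w x) j)%:R / n%:R : R)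
    = (fun n => D n / n%:R
         + (\sum_(j < n) word_at (c \o f i) w j)%:R / n%:R / b%:R).
    by apply/funext => n; rewrite /D; ring.
  rewrite size_rcons exprSr invfM mulrA -[X in _ --> X]add0r.
  apply: cvgD; last by apply: cvgMl.
  have [C HC] := Hc (i, w, Ordinal xb).
  have [A HA] := f_lin i.
  (* For [n >= 1], [f i (n + size w) <= A * (n + size w).+1 <= A * (size w).+2 * n]. *)
  apply: (@cvg_div_of_sq_le _ _ (`|C| * (A * (size w).+2)%:R)).
  near=> n.
  have n0 : (0 < n)%N by near: n; exact: nbhs_infty_gt.
  (* The gain bound holds only at times beyond the code of the strategy. *)
  have fn : (n <= f i (n + size w))%N.
    apply: (@leq_trans (n + size w)); first exact: leq_addr.
    elim: (n + size w)%N => // k IHk; exact: leq_ltn_trans IHk (f_mono _ _ _ _).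
  have := HC (f i (n + size w)%N).
  rewrite /= (@sum_bet R b (f i) w (f_mono i)) -/(D n).
  have pn : (pickle (i, w, Ordinal xb) < n)%N.
    by near: n; exact: nbhs_infty_gt.
  move=> /(_ (leq_trans pn fn)) /le_trans; apply.
  apply: (@le_trans _ _ (`|C| * (f i (n + size w)%N)%:R)).
    by rewrite ler_wpM2r // ler_norm.
  rewrite -mulrA ler_wpM2l // -natrM ler_nat (leq_trans (HA _)) // -mulnA leq_mul2l.
  by apply/orP; right; nia.
move=> k d _.
under eq_fun do rewrite occurrencesE.
have := word_freq (map val d); rewrite size_map size_tuple; apply.
by apply/allP => _ /mapP[x _ ->]; exact: ltn_ord.
Unshelve. all: by end_near. Qed.

(** * From normal digit sequences to normal numbers *)

(** If all digits after position [n] were [b - 1], which is not 0, the digit 0 would occur at most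
    [n] times and have frequency 0 instead of [1 / b]. *)
Lemma normal_digits_inf (R : realType) (b : nat) (a : nat -> nat) :
  (1 < b)%N -> normal_digits R b a ->
  forall n, exists2 m, (n < m)%N & (a m).+1 <> b.
Proof.
move=> b1 Na n; apply: contrapT => Hn.
have b0 : (0 < b)%N by exact: ltnW.
have am m : (n < m)%N -> (a m).+1 = b.
  by move=> nm; apply: contrapT => H; apply: Hn; exists m.
have := Na 1%N [tuple Ordinal b0] isT.
have : (fun k => (occurrences a [tuple Ordinal b0] k)%:R / k%:R : R) @ \oo --> 0.
  apply: (@cvg_div_of_sq_le _ _ (n%:R ^+ 2)); near=> k.
  have k0 : (0 < k)%N by near: k; exact: nbhs_infty_gt.
  rewrite occurrencesE.
  set P := word_at _ _.
  have : (\sum_(i < k) P i <= n)%N.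
    rewrite -(big_mkord xpredT (fun i => P i : nat)).
    rewrite (@big_cat_nat _ _ _ n) //=; last by near: k; exact: nbhs_infty_ge.
    have -> : (\sum_(n <= i < k) P i = 0)%N.
      rewrite big_nat_cond; apply: big1 => i; rewrite andbT => /andP[ni _].
      rewrite /P /word_at /mkseq /= addn0 eqseq_cons andbT; case: eqP => // a0.
      have : (n < i.+1)%N by [].
      by move=> /am; rewrite a0 => H; rewrite -H in b1.
    rewrite addn0 big_mkord -[leqRHS]card_ord -sum1_card.
    by apply: leq_sum => i _; case: (P i).
  move: (\sum_(_ < _) _)%N => s sn; rewrite -!natrX -natrM ler_nat.
  by rewrite (@leq_trans (n ^ 2)%N) ?leq_sqr ?leq_pmulr.
move=> H0 /(cvg_unique _ H0) => /(_ (@norm_hausdorff _ _)) /esym/eqP.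
rewrite mul1r expr1 invr_eq0 pnatr_eq0; lia.
Unshelve. all: by end_near. Qed.
Lemma normal_digits_ext (R : realType) b a a' :
  (forall i, a i.+1 = a' i.+1) -> normal_digits R b a -> normal_digits R b a'.
Proof.
move=> /funext aa' Na k d k0.
have -> : occurrences a' d = occurrences a d; last exact: Na.
by apply/funext => n; rewrite !occurrencesE aa'.
Qed.

Lemma normal_of_digits (R : realType) b c :
  (1 < b)%N -> (forall i, (c i < b)%N) -> normal_digits R b c ->
  normal b (of_digits R b c).
Proof.
move=> b1 cb Nc; have b0 := ltnW b1; have cinf := normal_digits_inf b1 Nc.
split; first exact: of_digits_ge0_lt1.
by apply: normal_digits_ext Nc => i; rewrite digit_of_digits.
Qed.

(** * The doubled sequence *)

(* The word [0, 1] cannot straddle two equal digits, so it only starts at odd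
   positions of the doubled sequence. *)
Lemma occurrences_doubled b (b0 : (0 < b)%N) (b1 : (1 < b)%N) (c : nat -> nat) n :
  occurrences (fun i => c i./2) [tuple Ordinal b0; Ordinal b1] (n * 2)
    = occurrences (fun i => c i.-1) [tuple Ordinal b0; Ordinal b1] n.
Proof.
have occS a m : occurrences a [tuple Ordinal b0; Ordinal b1] m.+1 =
    (occurrences a [tuple Ordinal b0; Ordinal b1] m
     + word_at (fun i => a i.+1) [:: 0; 1] m)%N.
  by rewrite !occurrencesE big_ord_recr.
elim: n => [|n IH]; first by rewrite !occurrencesE !big_ord0.
rewrite mulSn !occS IH -addnA; congr (_ + _)%N.
(* The two new windows read [c n, c n.+1] and [c n.+1, c n.+1]; the second is never [0, 1]. *)
rewrite /word_at /mkseq /= !addn0 !addn1 muln2 /= uphalf_double doubleK.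
by rewrite [X in (_ + X)%N](_ : _ = 0%N) ?addn0 // !eqseq_cons; case: eqP => //= ->.
Qed.

Lemma doubled_not_normal (R : realType) b (c : nat -> nat) :
  (1 < b)%N -> normal_digits R b (fun i => c i.-1) ->
  ~ normal_digits R b (fun i => c i./2).
Proof.
move=> b1 Nc Na; have b0 := ltnW b1; pose d := [tuple Ordinal b0; Ordinal b1].
(* Normality of the doubled sequence, restricted to even lengths, gives [1 / b ^ 2] for a limit that
   normality of [c] makes half as large. *)
have u2 : ((occurrences (fun i => c i.-1) d n)%:R / n%:R / 2 : R) @[n --> \oo] -->
          (1 / b%:R ^+ 2 : R).
  have -> : (fun n => (occurrences (fun i => c i.-1) d n)%:R / n%:R / 2 : R) =
      (fun n => (occurrences (fun i => c i./2) d n)%:R / n%:R : R) \o (muln^~ 2%N).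
    by apply/funext => n /=; rewrite occurrences_doubled natrM invfM mulrA.
  by apply: cvg_comp (Na _ d isT); exact: cvg_mulnr.
have u1 : ((occurrences (fun i => c i.-1) d n)%:R / n%:R / 2 : R) @[n --> \oo] -->
          (1 / b%:R ^+ 2 / 2 : R).
  by apply: cvgMl; exact: Nc.
have : 1 / b%:R ^+ 2 / 2 = 1 / b%:R ^+ 2 :> R by exact: cvg_unique u1 u2.
have : 0 < 1 / b%:R ^+ 2 :> R by rewrite divr_gt0 // exprn_gt0 // ltr0n.
move: (1 / _) => v; lra.
Qed.

Theorem theorem1p1 (R : realType) (b : nat) (hb : (2 <= b)%N) :
  exists x : R,
    [/\ 0 <= x < 1,
        ~ normal b x
      & forall k l : nat, (1 <= k)%N -> (2 <= l)%N ->
          normal b (of_digits R b (progression (digit b x) k l))].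
Proof.
have b0 := ltnW hb.
(* The progression from [k] with difference [l + 2] reads [c] at these halves; a difference of at
   least 2 makes them strictly increasing. *)
pose f (kl : nat * nat) n := (kl.1 + n * kl.2.+2)./2.
have [||c cb Nc] := @simultaneous_normal R b (nat * nat)%type f b0.
- by move=> [k l] m n mn; rewrite /f /=; nia.
- by move=> [k l]; exists (k + l.+2)%N => n; rewrite /f /=; nia.
(* The pair [(1, 0)] gives [f n = n], so [c] itself is normal. *)
have Nc0 : normal_digits R b (fun i => c i.-1).
  by apply: normal_digits_ext (Nc (1, 0)%N) => i; rewrite /f /= muln2 uphalf_double.
pose a i := c i./2.
(* Since [a] is not normal, its digits other than [b - 1] are taken from [c]: position [m.-1.*2] of
   [a] carries [c m.-1]. *)
have ainf n : exists2 m, (n < m)%N & (a m).+1 <> b.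
  have [m nm cm] := normal_digits_inf hb Nc0 n.+1.
  by exists m.-1.*2; [lia | rewrite /a doubleK].
have ab i : (a i < b)%N by exact: cb.
exists (of_digits R b a); split; first exact: of_digits_ge0_lt1.
  move=> [_ Nx]; apply: (doubled_not_normal hb Nc0).
  by apply: normal_digits_ext Nx => i; rewrite digit_of_digits.
move=> k l k1 l2.
have -> : progression (digit b (of_digits R b a)) k l
        = (fun n => c (f (k, l.-2) n.-1)).
  (* As [k >= 1], index 0, where [digit] need not return [a], is never read. *)
  apply/funext => i; rewrite /progression digit_of_digits ?addn_gt0 ?k1 //.
  by rewrite /a /f /=; congr (c (_ + _ * _)./2); lia.
by apply: normal_of_digits => // i; exact: cb.
Qed.
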